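(* Every (nonempty) simply connected length space $X$ satisfies $d_{\mathrm{GH}}(X,\mathbb{S}^1)\geq\frac{\pi}{4}$.
   Context: $\mathbb{S}^1=\{z\in\mathbb{R}^2 : \|z\|=1\}$ is equipped with its intrinsic (geodesic) metric $d_{\mathbb{S}^1}$, i.e. $d_{\mathbb{S}^1}(p,q)\in[0,\pi]$ is the angle between $p$ and $q$ seen as vectors of $\mathbb{R}^2$. For a metric space $(Z,d_Z)$ and nonempty $A,B\subseteq Z$, let $d_Z(z,A)=\inf_{a\in A}d_Z(z,a)$ and let the Hausdorff distance be $d_{\mathrm{H}}^Z(A,B)=\max\left(\sup_{a\in A}d_Z(a,B),\sup_{b\in B}d_Z(b,A)\right)$. The Gromov-Hausdorff distance between nonempty metric spaces $X,Y$ is the value in $[0,\infty]$ given by $d_{\mathrm{GH}}(X,Y)=\inf d_{\mathrm{H}}^Z(X',Y')$, the infimum being over all metric spaces $Z$ and subspaces $X',Y'\subseteq Z$ with $X'$ isometric to $X$ and $Y'$ isometric to $Y$. A metric space $(X,d_X)$ is a length space if for all $x,x'\in X$ the distance $d_X(x,x')$ is the infimum of the lengths of paths $\gamma:[0,1]\to X$ from $x$ to $x'$. *)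

(* Defs.v *)
From HB Require Import structures.
From mathcomp Require Import all_boot all_order all_algebra.
From mathcomp Require Import all_classical all_reals all_analysis.
From mathcomp Require Import ring.

Set Implicit Arguments.
Unset Strict Implicit.
Unset Printing Implicit Defensive.

Import Order.TTheory GRing.Theory Num.Theory.
Import numFieldNormedType.Exports.

Local Open Scope classical_set_scope.
Local Open Scope ring_scope.

(* The norm that the library puts on R * R is the max norm, hence this one. *)
Definition eucl_norm (R : realType) (z : R * R) : R :=
  Num.sqrt (z.1 ^+ 2 + z.2 ^+ 2).

Record circle (R : realType) := Circle {
  circle_val :> R * R;
  _ : eucl_norm circle_val == 1
}.

HB.instance Definition _ (R : realType) := [isSub for @circle_val R].
HB.instance Definition _ (R : realType) := [Choice of circle R by <:].

Definition circle_dot (R : realType) (p q : circle R) : R :=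
  p.1 * q.1 + p.2 * q.2.

Definition circle_dist (R : realType) (p q : circle R) : R :=
  acos (circle_dot p q).

Section circle_metric.
Variable R : realType.
Implicit Types p q r : circle R.

Lemma circle_eq1 p : p.1 ^+ 2 + p.2 ^+ 2 = 1.
Proof.
case: p => z /= /eqP zE; have z0 : 0 <= z.1 ^+ 2 + z.2 ^+ 2.
  by rewrite addr_ge0 ?sqr_ge0.
by rewrite -(sqr_sqrtr z0) -/(eucl_norm z) zE expr1n.
Qed.

Let cross p q : R := p.1 * q.2 - p.2 * q.1.

Let dot_cross p q : circle_dot p q ^+ 2 + cross p q ^+ 2 = 1.
Proof.
transitivity ((p.1 ^+ 2 + p.2 ^+ 2) * (q.1 ^+ 2 + q.2 ^+ 2)).
  by rewrite /circle_dot /cross; ring.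
by rewrite !circle_eq1 mulr1.
Qed.

Let dot_chain p q r :
  circle_dot p r = circle_dot p q * circle_dot q r - cross p q * cross q r.
Proof.
transitivity (circle_dot p r * (q.1 ^+ 2 + q.2 ^+ 2)).
  by rewrite circle_eq1 mulr1.
by rewrite /circle_dot /cross; ring.
Qed.

Lemma circle_dot_bound p q : -1 <= circle_dot p q <= 1.
Proof.
rewrite -ler_norml -(@ler_pXn2r _ 2) ?nnegrE// expr1n real_normK ?num_real//.
by rewrite -(dot_cross p q) lerDl sqr_ge0.
Qed.

Let dist_itv p q : 0 <= circle_dist p q <= pi.
Proof. by rewrite acos_ge0 ?acos_lepi// circle_dot_bound. Qed.

Let cos_dist p q : cos (circle_dist p q) = circle_dot p q.
Proof. by rewrite acosK// in_itv/= circle_dot_bound. Qed.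

Let sin_dist p q : sin (circle_dist p q) = `|cross p q|.
Proof.
rewrite sin_acos ?circle_dot_bound//.
by rewrite -(dot_cross p q) addrAC subrr add0r sqrtr_sqr.
Qed.

Let circle_distxx p : circle_dist p p = 0.
Proof. by rewrite /circle_dist /circle_dot -!expr2 circle_eq1 acos1. Qed.

Let circle_dist_eq0 p q : circle_dist p q = 0 -> p = q.
Proof.
move=> pq0; have := cos_dist p q; rewrite pq0 cos0 => pq1.
have e : (p.1 - q.1) ^+ 2 + (p.2 - q.2) ^+ 2 = 0.
  transitivity (p.1 ^+ 2 + p.2 ^+ 2 + (q.1 ^+ 2 + q.2 ^+ 2)
      - circle_dot p q *+ 2); first by rewrite /circle_dot; ring.
  by rewrite !circle_eq1 -pq1 subrr.
move/eqP: e; rewrite paddr_eq0 ?sqr_ge0// !sqrf_eq0 !subr_eq0.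
move=> /andP[/eqP e1 /eqP e2]; apply: val_inj => /=.
by case: (circle_val p) (circle_val q) e1 e2 => ? ? [? ?] /= -> ->.
Qed.

Let circle_distC p q : circle_dist p q = circle_dist q p.
Proof.
by rewrite /circle_dist /circle_dot mulrC [X in _ + X]mulrC.
Qed.

Let circle_dist_triangle q p r :
  circle_dist p r <= circle_dist p q + circle_dist q r.
Proof.
have /andP[a0 _] := dist_itv p q; have /andP[b0 _] := dist_itv q r.
have /andP[c0 cpi] := dist_itv p r.
have [abpi|abpi] := lerP pi (circle_dist p q + circle_dist q r).
  exact: le_trans abpi.
rewrite leNgt -ltr_cos ?in_itv/= ?addr_ge0 ?c0 ?cpi ?(ltW abpi)//.
rewrite cosD !sin_dist !cos_dist (dot_chain p q r) -leNgt lerD2l lerN2.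
by rewrite -normrM ler_norm.
Qed.

HB.instance Definition _ := @isMetric.Build R (circle R) (@circle_dist R)
  circle_distxx circle_dist_eq0 circle_distC circle_dist_triangle.

End circle_metric.

Section hausdorff.
Variables (R : realType) (Z : metricType R).
Implicit Types A B : set Z.

Local Open Scope ereal_scope.

Definition dist_to_set (z : Z) A : \bar R :=
  ereal_inf [set (mdist z a)%:E | a in A].

Definition hausdorff_dist A B : \bar R :=
  maxe (ereal_sup [set dist_to_set a B | a in A])
       (ereal_sup [set dist_to_set b A | b in B]).

End hausdorff.

Definition isometric_to_subspace (R : realType) (X Z : metricType R)
    (X' : set Z) : Prop :=
  exists2 f : X -> Z, set_bij [set: X] X' f &
    forall x y, mdist (f x) (f y) = mdist x y.

Definition gromov_hausdorff_dist (R : realType) (X Y : metricType R) : \bar R :=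
  ereal_inf [set r | exists (Z : metricType R) (X' Y' : set Z),
    [/\ isometric_to_subspace X X', isometric_to_subspace Y Y' &
        r = hausdorff_dist X' Y']].

(* A path [0, 1] -> X is encoded by a function R -> X whose values outside
   [0, 1] are irrelevant. *)
Definition path_between (R : realType) (X : topologicalType) (x y : X)
    (g : R -> X) : Prop :=
  [/\ {within `[0, 1], continuous g}, g 0 = x & g 1 = y].

Definition path_length (R : realType) (X : metricType R) (g : R -> X)
    : \bar R :=
  ereal_sup [set (\sum_(0 <= i < size s)
      mdist (g (nth 1 (0 :: s) i)) (g (nth 1 (0 :: s) i.+1)))%:E
    | s in itv_partition 0 1].

Definition length_space (R : realType) (X : metricType R) : Prop :=
  forall x y : X,
    (mdist x y)%:E = ereal_inf [set path_length g | g in path_between x y].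

Definition path_connected (R : realType) (X : topologicalType) : Prop :=
  forall x y : X, exists g : R -> X, path_between x y g.

Definition path_homotopic (R : realType) (X : topologicalType) (x y : X)
    (g0 g1 : R -> X) : Prop :=
  exists2 H : R * R -> X, {within `[0, 1] `*` `[0, 1], continuous H} &
    forall t, t \in `[0, 1] ->
      [/\ H (0, t) = g0 t, H (1, t) = g1 t, H (t, 0) = x & H (t, 1) = y].

Definition simply_connected (R : realType) (X : topologicalType) : Prop :=
  path_connected R X /\
  forall (x : X) (g : R -> X),
    path_between x x g -> path_homotopic x x g (cst x).

(* Main.v *)
Require Import Defs.
From mathcomp Require Import all_boot all_order all_algebra.
From mathcomp Require Import all_classical all_reals all_analysis.
From mathcomp Require Import ring lra.

(** Suppose that the distance is below pi / 4. Then X and the circle are related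
by a correspondence C of distortion d < pi / 2; let f : X -> circle be a
selection of C. The map f need not be continuous, yet it has winding numbers.
The reason is that signed angles are additive along closed polygons of
perimeter below 2 pi (signed_angle_quad): their sum is an integer multiple of
2 pi, too small to be nonzero. Points of X at distance at most h have images at
distance at most d + h, so a small square of X is sent to a quadrilateral of
perimeter at most 4 (d + h), which is below 2 pi when h is small. Summing over a
fine grid on a null homotopy (winding_grid) shows that f winds zero times
around the circle along a fine sampling of any contractible loop
(nullhomotopic_winding).

A loop along which f winds exactly once contradicts this. Take a regular N-gon
p_0, ..., p_N = p_0 on the circle, with step h = 2 pi / N, and points x_k of X
corresponding to the p_k. Then x_k and x_(k+1) are at distance at most d + h,
and the length-space property joins them by a path of length less than d + 2 h.
Each point y of that path is close, within about half that length, to x_k or to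
x_(k+1), hence f y is within about 3 d / 2 of p_k or of p_(k+1). All triangles
that have one vertex at p_k or p_(k+1) and two consecutive sampled images as
the others then have perimeter at most 4 (d + h), so the winding along the
path is the angle h from p_k to p_(k+1), up to end corrections which cancel
around the loop (winding_short_chain). The total is N h = 2 pi.

The bound pi / 4 enters once, as d < pi / 2: it is what makes 4 d < 2 pi, both
for the small squares and for these triangles. *)

Set Implicit Arguments.
Unset Strict Implicit.
Unset Printing Implicit Defensive.

Import Order.TTheory GRing.Theory Num.Theory.
Import numFieldNormedType.Exports.

Local Open Scope classical_set_scope.
Local Open Scope ring_scope.

(** * Signed angles on the circle *)

Section signed_angle.
Variable R : realType.
Implicit Types p q r : circle R.

(** With circle_dot, the sine and cosine of the oriented angle from p to q. *)
Definition circle_cross p q : R := p.1 * q.2 - p.2 * q.1.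

(** The representative in ]-pi, pi] of the oriented angle from p to q. Antipodal
points get pi in both orders, so the angle is antisymmetric only below distance
pi. *)
Definition signed_angle p q : R :=
  if 0 <= circle_cross p q then mdist p q else - mdist p q.

Lemma circle_mdistE p q : mdist p q = acos (circle_dot p q).
Proof. by []. Qed.

Lemma circle_dot_cross p q : circle_dot p q ^+ 2 + circle_cross p q ^+ 2 = 1.
Proof.
transitivity ((p.1 ^+ 2 + p.2 ^+ 2) * (q.1 ^+ 2 + q.2 ^+ 2)).
  by rewrite /circle_dot /circle_cross; ring.
by rewrite !circle_eq1 mulr1.
Qed.

Lemma normr_signed_angle p q : `|signed_angle p q| = mdist p q.
Proof.
by rewrite /signed_angle; case: ifP => _; rewrite ?normrN ger0_norm ?mdist_ge0.
Qed.

Lemma cos_signed_angle p q : cos (signed_angle p q) = circle_dot p q.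
Proof.
rewrite /signed_angle; case: ifP => _; rewrite ?cosN circle_mdistE acosK//;
  by rewrite in_itv/= circle_dot_bound.
Qed.

Lemma sin_signed_angle p q : sin (signed_angle p q) = circle_cross p q.
Proof.
have sE : sin (acos (circle_dot p q)) = `|circle_cross p q|.
  rewrite sin_acos ?circle_dot_bound//.
  by rewrite -(circle_dot_cross p q) addrAC subrr add0r sqrtr_sqr.
rewrite /signed_angle; case: ifPn => [c0|]; rewrite circle_mdistE ?sinN sE.
  by rewrite ger0_norm.
by rewrite -ltNge => c0; rewrite ltr0_norm// opprK.
Qed.

Lemma signed_anglexx p : signed_angle p p = 0.
Proof. by apply/eqP; rewrite -normr_eq0 normr_signed_angle mdistxx. Qed.

Lemma signed_angle_small p q (a : R) : cos a = circle_dot p q ->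
  sin a = circle_cross p q -> 0 <= a <= pi -> signed_angle p q = a.
Proof.
move=> ca sa /andP[a0 api].
rewrite /signed_angle -sa sin_ge0_pi ?a0// circle_mdistE -ca.
by rewrite cosK// in_itv/= a0.
Qed.

Lemma cos_eq1_small (x : R) : cos x = 1 -> `|x| < pi *+ 2 -> x = 0.
Proof.
wlog x0 : x / 0 <= x => [hw|].
  have [/hw//|/ltW xle0] := leP 0 x.
  move=> c1 xpi; apply/oppr_inj; rewrite oppr0; apply: hw.
  - by rewrite oppr_ge0.
  - by rewrite cosN.
  - by rewrite normrN.
rewrite ger0_norm// => c1 xpi.
have xE : x = (x / 2) *+ 2 by rewrite -mulr_natr divfK.
have s0 : sin (x / 2) = 0.
  apply/eqP; rewrite -sqrf_eq0; apply/eqP.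
  have := cos2Dsin2 (x / 2); have := cos_mulr2n (x / 2).
  by rewrite -xE c1; lra.
have [x_gt0|xle0] := ltP 0 x; last by apply/eqP; rewrite eq_le x0 xle0.
suff : 0 < sin (x / 2) by rewrite s0 ltxx.
by apply: sin_gt0_pi; apply/andP; split; lra.
Qed.

(** Both routes from p to r represent the same oriented angle, so their
difference is a multiple of 2 pi; the bound on the perimeter leaves only 0. *)
Lemma signed_angle_quad p q r q' :
  mdist p q + mdist q r + (mdist p q' + mdist q' r) < pi *+ 2 ->
  signed_angle p q + signed_angle q r = signed_angle p q' + signed_angle q' r.
Proof.
move=> small; apply/eqP; rewrite -subr_eq0; apply/eqP/cos_eq1_small; last first.
  apply: le_lt_trans small; rewrite -!normr_signed_angle.
  by rewrite (le_trans (ler_normB _ _))// lerD// ler_normD.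
have chain a b c :
    cos (signed_angle a b + signed_angle b c) = circle_dot a c /\
    sin (signed_angle a b + signed_angle b c) = circle_cross a c.
  rewrite cosD sinD !cos_signed_angle !sin_signed_angle; split.
    transitivity (circle_dot a c * (b.1 ^+ 2 + b.2 ^+ 2)).
      by rewrite /circle_dot /circle_cross; ring.
    by rewrite circle_eq1 mulr1.
  transitivity (circle_cross a c * (b.1 ^+ 2 + b.2 ^+ 2)).
    by rewrite /circle_dot /circle_cross; ring.
  by rewrite circle_eq1 mulr1.
have [c1 s1] := chain p q r; have [c2 s2] := chain p q' r.
by rewrite cosB c1 c2 s1 s2 -(circle_dot_cross p r) !expr2.
Qed.

Lemma signed_angle_triangle p q r :
  mdist p q + mdist q r + mdist p r < pi *+ 2 ->
  signed_angle p q + signed_angle q r = signed_angle p r.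
Proof.
move=> small; rewrite (@signed_angle_quad p q r p) ?signed_anglexx ?add0r//.
by rewrite mdistxx add0r.
Qed.

Lemma circle_point_subproof (a : R) : eucl_norm (cos a, sin a) == 1.
Proof. by rewrite /eucl_norm/= cos2Dsin2 sqrtr1. Qed.

Definition circle_point (a : R) : circle R := Circle (circle_point_subproof a).

Lemma signed_angle_circle_point (a b : R) : 0 <= b - a <= pi ->
  signed_angle (circle_point a) (circle_point b) = b - a.
Proof.
apply: signed_angle_small; rewrite ?cosB ?sinB /circle_dot /circle_cross/=; ring.
Qed.

Lemma circle_point_period : circle_point (pi *+ 2) = circle_point 0.
Proof. by apply: val_inj; rewrite /= cos2pi sin2pi cos0 sin0. Qed.

End signed_angle.

(** * Winding of polygonal chains *)

Section winding.
Variable R : realType.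

(** The net change of argument along the chain q 0, ..., q n; for a closed chain
it is 2 pi times an integer. *)
Definition winding (n : nat) (q : nat -> circle R) : R :=
  \sum_(0 <= j < n) signed_angle (q j) (q j.+1).

Lemma windingS n q : winding n.+1 q = winding n q + signed_angle (q n) (q n.+1).
Proof. by rewrite /winding big_nat_recr. Qed.

Lemma winding0 q : winding 0 q = 0.
Proof. by rewrite /winding big_geq. Qed.

Lemma winding_cst n q c : (forall j, (j <= n)%N -> q j = c) -> winding n q = 0.
Proof.
move=> qc; rewrite /winding big_nat big1// => j /andP[_ jn].
by rewrite !qc ?signed_anglexx// ltnW.
Qed.

(** The rungs q j -- q' j cut the strip between the two chains into
quadrilaterals; by signed_angle_quad the winding around each of them vanishes,
and the inner rungs cancel. *)
Lemma winding_ladder n (q q' : nat -> circle R) :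
  (forall j, (j < n)%N ->
    mdist (q j) (q j.+1) + mdist (q j.+1) (q' j.+1) +
    (mdist (q j) (q' j) + mdist (q' j) (q' j.+1)) < pi *+ 2) ->
  winding n q + signed_angle (q n) (q' n) =
  signed_angle (q 0%N) (q' 0%N) + winding n q'.
Proof.
elim: n => [|n ih] small; first by rewrite !winding0 add0r addr0.
rewrite !windingS addrA -ih; last by move=> j jn; apply/small/ltnW.
by rewrite -!addrA; congr (_ + _); apply/signed_angle_quad/small.
Qed.

(** Discrete homotopy invariance: consecutive rows form ladders whose two outer
rungs are degenerate because the sides of the grid are constant. *)
Lemma winding_grid n (G : nat -> nat -> circle R) c c' :
  (forall i j, (i < n)%N -> (j < n)%N ->
    mdist (G i j) (G i j.+1) + mdist (G i j.+1) (G i.+1 j.+1) +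
    (mdist (G i j) (G i.+1 j) + mdist (G i.+1 j) (G i.+1 j.+1)) < pi *+ 2) ->
  (forall i, (i <= n)%N -> G i 0%N = c /\ G i n = c') ->
  winding n (G 0%N) = winding n (G n).
Proof.
move=> small side.
suff row i : (i <= n)%N -> winding n (G 0%N) = winding n (G i) by exact: row.
elim: i => // i ih lt_in; rewrite ih ?(ltnW lt_in)//.
have := @winding_ladder n (G i) (G i.+1) (fun j => small i j lt_in).
have [-> ->] := side i (ltnW lt_in); have [-> ->] := side i.+1 lt_in.
by rewrite !signed_anglexx addr0 add0r.
Qed.

End winding.

(** * Images of short chains under a correspondence *)

Section short_chain.
Variables (R : realType) (X : metricType R).

Lemma mdist_chain (y : nat -> X) i j : (i <= j)%N ->
  mdist (y i) (y j) <= \sum_(i <= k < j) mdist (y k) (y k.+1).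
Proof.
elim: j => [|j ih]; first by rewrite leqn0 => /eqP ->; rewrite mdistxx big_geq.
rewrite leq_eqVlt => /predU1P[->|]; first by rewrite mdistxx big_geq.
rewrite ltnS => ij; rewrite big_nat_recr//=.
by rewrite (le_trans (metric_triangle _ (y j) _))// lerD// ih.
Qed.

Definition distortion_le (C : X -> circle R -> Prop) (d : R) :=
  forall x x' p p', C x p -> C x' p' -> `|mdist x x' - mdist p p'| <= d.

Variables (C : X -> circle R -> Prop) (d h : R).
Hypothesis Cd : distortion_le C d.
Hypothesis h0 : 0 <= h.
Hypothesis small : d *+ 4 + h *+ 4 < pi *+ 2.

Lemma mdist_circle_le x x' p p' (e : R) :
  C x p -> C x' p' -> mdist x x' <= e -> mdist p p' <= e + d.
Proof.
by move=> xp xp' xe; have := Cd xp xp'; rewrite ler_norml => /andP[]; lra.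
Qed.

(** A chain of length at most L = d + 2 h stays close to its first point while
the length already covered is at most L / 2, and close to its last point
afterwards. Angles of the images are measured from p in the first phase and
from p' in the second. Every triangle involved has perimeter at most
4 d + 4 h: for instance a fan triangle at p has sides at most
d + L / 2, d + h and d + L / 2 + h. *)
Lemma winding_short_chain m (y : nat -> X) (q : nat -> circle R) p p' :
  C (y 0%N) p -> C (y m) p' -> mdist p p' <= h ->
  (forall j, C (y j) (q j)) ->
  (forall j, (j < m)%N -> mdist (y j) (y j.+1) <= h) ->
  \sum_(0 <= j < m) mdist (y j) (y j.+1) <= d + h *+ 2 ->
  signed_angle p (q 0%N) + winding m q =
  signed_angle p p' + signed_angle p' (q m).
Proof.
move=> p0 pm pp' Cq step lenL.
pose len j := \sum_(0 <= k < j) mdist (y k) (y k.+1).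
have [L LE] : {L | L = d + h *+ 2} by exists (d + h *+ 2).
have lenS j : len j.+1 = len j + mdist (y j) (y j.+1).
  by rewrite /len big_nat_recr.
have qq j : (j < m)%N -> mdist (q j) (q j.+1) <= h + d.
  by move=> jm; apply: mdist_circle_le (step j jm).
have pq j : mdist p (q j) <= len j + d.
  by apply: mdist_circle_le p0 (Cq j) _; exact: mdist_chain.
have p'q j : (j <= m)%N -> mdist p' (q j) <= len m - len j + d.
  move=> jm; apply: mdist_circle_le pm (Cq j) _; rewrite metric_sym.
  apply: le_trans (mdist_chain y jm) _.
  suff -> : len m = len j + \sum_(j <= k < m) mdist (y k) (y k.+1) by lra.
  by rewrite /len -big_cat_nat.
have lenm : len m <= L by rewrite LE.
have d0 : 0 <= d by apply: le_trans (Cd p0 p0).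
(* At such a j the angle of q j may be measured from p or from p'. *)
have switch j : (j <= m)%N -> mdist p (q j) + mdist p' (q j) <= L + h + d *+ 2 ->
    signed_angle p (q j) = signed_angle p p' + signed_angle p' (q j).
  move=> jm hj; rewrite signed_angle_triangle//.
  by move: small hj pp'; lra.
(* The accumulated winding is the angle from p to q j, measured directly in
   the first phase and through p' in the second. *)
suff claim j : (j <= m)%N -> signed_angle p (q 0%N) + winding j q =
    if len j <= L / 2 then signed_angle p (q j)
    else signed_angle p p' + signed_angle p' (q j).
  rewrite claim//; case: ifP => // lenm2; apply: switch => //.
  by have := pq m; have := p'q m (leqnn m); move: lenm2 d0 h0; lra.
elim: j => [_|j ih jm].
  rewrite winding0 addr0 [len 0%N]/len big_geq//.
  by rewrite divr_ge0// LE addr_ge0// mulrn_wge0.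
have d1 := pq j; have d2 := pq j.+1; have d3 := p'q j (ltnW jm).
have d4 := p'q j.+1 jm; have d5 := qq j jm; have d6 := step j jm.
have lS := lenS j; have d7 := mdist_ge0 (y j) (y j.+1).
have sm := small; have h_ge0 := h0.
rewrite windingS addrA ih ?(ltnW jm)//.
case: (leP (len j) _) => lj; case: (leP (len j.+1) _) => ljS.
- by rewrite signed_angle_triangle//; lra.
- by rewrite -switch//; [rewrite signed_angle_triangle//; lra|lra].
- by lra.
- by rewrite -addrA; congr (_ + _); apply: signed_angle_triangle; lra.
Qed.

End short_chain.

(** * Paths *)

(** Heine-Cantor on a compact subset, as a near-covering argument over the
radius. *)
Lemma within_uniformly_continuous (R : realType) (T : pseudoMetricType R)
    (X : metricType R) (K : set T) (f : T -> X) (e : R) :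
  compact K -> {within K, continuous f} -> 0 < e ->
  exists2 r : R, 0 < r &
    forall z z', K z -> K z' -> ball z r z' -> mdist (f z) (f z') < e.
Proof.
move=> /compact_near_coveringP/near_covering_withinP cK /subspace_continuousP cf.
move=> e0.
pose P (r : R) z := forall z', K z' -> ball z r z' -> mdist (f z) (f z') < e.
have /cK : forall x, K x -> \forall z \near x & r \near 0^'+, K z -> P r z.
  move=> x Kx.
  have e20 : 0 < e / 2 by rewrite divr_gt0.
  have := cf x Kx => /metricType_numDomainType.cvgrPdist_lt /(_ _ e20).
  move=> /nbhs_ballP[s /= s0 fs].
  have s20 : 0 < s / 2 by rewrite divr_gt0.
  exists (ball x (s / 2), [set r | r < s / 2]) => /=.
    by split; [exact: nbhsx_ballx|exact: nbhs_right_lt].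
  move=> [z r] /= [xz rs] Kz z' Kz' zz'.
  have xz' : ball x s z'.
    by rewrite (splitr s); apply: ball_triangle xz _; exact: le_ball (ltW rs) _ zz'.
  rewrite (le_lt_trans (metric_triangle _ (f x) _))// (splitr e) ltrD//.
    by rewrite metric_sym fs//; apply: le_ball xz; lra.
  exact: fs.
move=> KP; have [r [r0 Kr]] : exists r : R, 0 < r /\ K `<=` P r.
  near (0 : R)^'+ => r; exists r; split; first by near: r; exact: nbhs_right_gt.
  by near: r; exact: KP.
by exists r => // z z' Kz; exact: Kr.
Unshelve. all: end_near. Qed.

Lemma within_continuous_precomp (S T U : topologicalType) (A : set S)
    (B : set T) (g : S -> T) (f : T -> U) :
  {homo g : s / A s >-> B s} -> continuous g -> {within B, continuous f} ->
  {within A, continuous f \o g}.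
Proof.
move=> gAB cg /subspace_continuousP cf; apply/subspace_continuousP => s As.
apply: cvg_comp (cf _ (gAB _ As)).
move=> V /cg /=; rewrite /within/= !nbhs_simpl /= => gV.
by apply: filterS gV => t /= + At; apply; exact: gAB.
Qed.

Section concatenation.
Variables (R : realType) (X : topologicalType) (g : nat -> R -> X).

(** The infinite concatenation, with g k run through on [k, k + 1]. Its value at
an integer k is g k 0, which agrees with g (k - 1) 1 when the ends match. *)
Definition concat_paths (t : R) : X :=
  g (Num.truncn t) (t - (Num.truncn t)%:R).

Hypothesis g_end : forall k, g k 1 = g k.+1 0.

Lemma concat_pathsE k t : k%:R <= t <= k.+1%:R ->
  concat_paths t = g k (t - k%:R).
Proof.
move=> /andP[kt]; rewrite le_eqVlt => /predU1P[->|tk].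
  by rewrite /concat_paths natrK subrr -g_end -natr1 addrAC subrr add0r.
rewrite /concat_paths; suff -> : Num.truncn t = k by [].
by apply/eqP; rewrite truncn_eq ?kt// (le_trans _ kt).
Qed.

Lemma concat_paths_continuous n :
  (forall k, {within `[0, 1], continuous (g k)}) ->
  {within `[0, n%:R], continuous concat_paths}.
Proof.
move=> cg; elim: n => [|n ih].
  by rewrite set_itv1; exact: continuous_subspace1.
have -> : `[(0 : R), n.+1%:R]%classic = `[0, n%:R] `|` `[n%:R, n.+1%:R].
  apply/seteqP; split=> t /=; rewrite !in_itv/= -natr1.
    by case: (leP t n%:R) => [tn /andP[-> _]|tn /andP[_ ->]];
      [left|right; rewrite (ltW tn)].
  move=> [/andP[-> tn]|/andP[nt ->]].
    by rewrite (le_trans tn)// lerDl.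
  by rewrite (le_trans _ nt)//.
apply: withinU_continuous => //; try exact: interval_closed.
have : {within `[n%:R, n.+1%:R], continuous (g n \o (fun t => t - n%:R))}.
  apply: within_continuous_precomp (cg n).
    by move=> t /=; rewrite !in_itv/= -natr1 => /andP[? ?]; apply/andP; split; lra.
  by move=> t; apply: cvgB; [exact: cvg_id|exact: cvg_cst].
apply: subspace_eq_continuous => t; rewrite inE/= in_itv/= => tn.
exact/esym/concat_pathsE.
Qed.

End concatenation.

Lemma sum_mdist_le_path_length (R : realType) (X : metricType R) (g : R -> X) m :
  (0 < m)%N ->
  ((\sum_(0 <= i < m) mdist (g (i%:R / m%:R)) (g (i.+1%:R / m%:R)))%:E
    <= path_length g)%E.
Proof.
move=> m0; apply: ereal_sup_ubound.
pose s : seq R := [seq i.+1%:R / m%:R | i <- iota 0 m].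
have nth_s i : (i <= m)%N -> nth 1 (0 :: s) i = i%:R / m%:R.
  case: i => [|i] im /=; first by rewrite mul0r.
  by rewrite (nth_map 0%N) ?size_iota// nth_iota.
have size_s : size s = m by rewrite size_map size_iota.
exists s; last first.
  rewrite size_s; congr _%:E; apply: eq_big_nat => i /andP[_ im].
  by rewrite !nth_s// ltnW.
split.
  apply/(pathP 1) => i; rewrite size_s => im.
  have -> : nth 1 s i = nth 1 (0 :: s) i.+1 by [].
  by rewrite !nth_s// 1?ltnW// ltr_pM2r ?invr_gt0 ?ltr0n// ltr_nat.
have -> : last 0 s = nth 1 (0 :: s) m.
  by rewrite -[in RHS]size_s nth_last.
by rewrite nth_s// divff// pnatr_eq0 -lt0n.
Qed.

Lemma length_space_short_path (R : realType) (X : metricType R) (x y : X)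
    (r : R) : length_space X -> mdist x y < r ->
  exists2 g : R -> X, path_between x y g & (path_length g < r%:E)%E.
Proof.
by move=> lX; rewrite -lte_fin lX => /ereal_inf_lt[_ [g xyg <-]]; exists g.
Qed.

Lemma exists_natr_gt (R : realType) (a : R) : exists2 n, (0 < n)%N & a < n%:R.
Proof.
exists (Num.truncn `|a|).+1 => //.
by rewrite (le_lt_trans (ler_norm a))// truncnS_gt.
Qed.

Lemma fraction_in01 (R : realType) (i n : nat) : (i <= n)%N ->
  0 <= (i%:R / n%:R : R) <= 1.
Proof.
case: n => [|n]; first by rewrite leqn0 => /eqP ->; rewrite mul0r lexx ler01.
by move=> i_n; rewrite divr_ge0//= ler_pdivrMr ?ltr0n// mul1r ler_nat.
Qed.

(** * Correspondences from the Gromov-Hausdorff distance *)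

(** Relate x and p when their images in the common space Z are closer than r;
the triangle inequality in Z gives the distortion 2 r. *)
Lemma gromov_hausdorff_correspondence (R : realType) (X : metricType R)
    (r : R) : (gromov_hausdorff_dist X (circle R) < r%:E)%E ->
  exists C : X -> circle R -> Prop,
    [/\ forall x, exists p, C x p, forall p, exists x, C x p &
        distortion_le C (r *+ 2)].
Proof.
move=> /ereal_inf_lt[_ [Z [X' [Y' [[f [fX' _ fsurj] fiso]
  [g [gY' _ gsurj] giso] ->]]]]].
rewrite /hausdorff_dist gt_max => /andP[XY YX].
exists (fun x p => mdist (f x) (g p) < r); split=> [x|p|x x' p p' xp x'p'].
- have : (dist_to_set (f x) Y' < r%:E)%E.
    apply: le_lt_trans XY; apply: ereal_sup_ubound; exists (f x) => //.
    exact: fX'.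
  move=> /ereal_inf_lt[_ [y /gsurj[p _ <-] <-]]; rewrite lte_fin => ?.
  by exists p.
- have : (dist_to_set (g p) X' < r%:E)%E.
    apply: le_lt_trans YX; apply: ereal_sup_ubound; exists (g p) => //.
    exact: gY'.
  move=> /ereal_inf_lt[_ [y /fsurj[x _ <-] <-]]; rewrite lte_fin => ?.
  by exists x; rewrite metric_sym.
- rewrite -fiso -giso.
  have := metric_triangle (f x) (g p) (f x').
  have := metric_triangle (g p) (g p') (f x').
  have := metric_triangle (g p) (f x) (g p').
  have := metric_triangle (f x) (f x') (g p').
  move: xp x'p'; rewrite (metric_sym (g p') (f x')) (metric_sym (g p) (f x)).
  by rewrite ler_norml => *; apply/andP; split; lra.
Qed.

(** * The winding contradiction *)

(** On a grid finer than a modulus of uniform continuity of the homotopy, f maps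
each cell to a quadrilateral with sides below pi / 2, so winding_grid applies;
the last row is constant. *)
Lemma nullhomotopic_winding (R : realType) (X : metricType R) (x : X)
    (G : R -> X) (f : X -> circle R) (e : R) : 0 < e ->
  (forall y y', mdist y y' < e -> mdist (f y) (f y') < pi / 2) ->
  path_homotopic x x G (cst x) ->
  exists2 r : R, 0 < r & forall n, n%:R^-1 < r ->
    (forall j, (j < n)%N -> mdist (G (j%:R / n%:R)) (G (j.+1%:R / n%:R)) < e) /\
    winding n (fun j => f (G (j%:R / n%:R))) = 0.
Proof.
move=> e0 fe [H cH HG].
have [r r0 Hr] := within_uniformly_continuous
  (compact_setX (@segment_compact R 0 1) (@segment_compact R 0 1)) cH e0.
exists r => // -[|n]; first by move=> _; split => //; rewrite winding0.
set m := n.+1 => mr.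
pose u (i : nat) : R := i%:R / m%:R.
have u01 i : (i <= m)%N -> u i \in `[0, 1].
  by move=> im; rewrite in_itv/= fraction_in01.
have u0 : u 0%N = 0 by rewrite /u mul0r.
have um : u m = 1 by rewrite /u divff// pnatr_eq0.
have uS i j : j = i \/ j = i.+1 -> ball (u i) r (u j).
  move=> [->|->]; first exact: ballxx.
  by rewrite /ball/= /u -mulrBl -natr1 opprD addrA subrr sub0r normrM normrN
    normr1 mul1r ger0_norm.
have step i j i' j' : [&& i <= m, j <= m, i' <= m & j' <= m]%N ->
    i' = i \/ i' = i.+1 -> j' = j \/ j' = j.+1 ->
    mdist (H (u i, u j)) (H (u i', u j')) < e.
  move=> /and4P[im jm im' jm'] ii' jj'; apply: Hr.
  - by split; exact: u01.
  - by split; exact: u01.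
  - by split; exact: uS.
have GE j : (j <= m)%N -> G (u j) = H (u 0%N, u j).
  by move=> jm; have [] := HG _ (u01 j jm); rewrite u0.
split=> [j jm|].
  by rewrite -!/(u _) !GE ?(ltnW jm)//; apply: step;
    rewrite /= ?(ltnW jm) ?jm; auto.
transitivity (winding m (fun j => f (H (u 0%N, u j)))).
  by rewrite /winding; apply: eq_big_nat => j /andP[_ jm];
    rewrite -!/(u _) !GE// ltnW.
have -> := @winding_grid R m (fun i j => f (H (u i, u j))) (f x) (f x).
- apply: (@winding_cst _ _ _ (f x)) => j jm.
  by rewrite um; have [_ ->] := HG _ (u01 j jm).
- move=> i j im jm.
  have stepf i1 j1 i2 j2 := fun le_m ii jj => fe _ _ (@step i1 j1 i2 j2 le_m ii jj).
  have le_m := (im, jm, ltnW im, ltnW jm).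
  have a1 : mdist (f (H (u i, u j))) (f (H (u i, u j.+1))) < pi / 2.
    by apply: stepf; rewrite ?le_m; auto.
  have a2 : mdist (f (H (u i, u j.+1))) (f (H (u i.+1, u j.+1))) < pi / 2.
    by apply: stepf; rewrite ?le_m; auto.
  have a3 : mdist (f (H (u i, u j))) (f (H (u i.+1, u j))) < pi / 2.
    by apply: stepf; rewrite ?le_m; auto.
  have a4 : mdist (f (H (u i.+1, u j))) (f (H (u i.+1, u j.+1))) < pi / 2.
    by apply: stepf; rewrite ?le_m; auto.
  by lra.
- move=> i im; rewrite u0 um.
  by have [_ _ -> ->] := HG _ (u01 i im).
Qed.

(** The N-gon argument: the loop through the x_k has winding 2 pi, but it is
contractible. *)
Lemma no_small_correspondence (R : realType) (X : metricType R)
    (C : X -> circle R -> Prop) (d : R) :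
  simply_connected R X -> length_space X ->
  (forall x, exists p, C x p) -> (forall p, exists x, C x p) ->
  distortion_le C d -> pi / 2 <= d.
Proof.
move=> [_ scX] lX /choice[f Cf] /choice[s Cs] Cd; rewrite leNgt; apply/negP => dpi.
have pi0 : 0 < pi :> R := pi_gt0 R.
(* N is chosen so that the step h of the N-gon satisfies 4 d + 4 h < 2 pi. *)
have [N N0 HN] := exists_natr_gt ((pi *+ 8) / (pi *+ 2 - d *+ 4)).
have NR0 : 0 < N%:R :> R by rewrite ltr0n.
pose h : R := pi *+ 2 / N%:R.
have h0 : 0 < h by rewrite divr_gt0// mulrn_wgt0.
have Nh : N%:R * h = pi *+ 2 by rewrite mulrC divfK// gt_eqF.
have small : d *+ 4 + h *+ 4 < pi *+ 2.
  move: HN; rewrite ltr_pdivrMr; last by lra.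
  move=> HN.
  have -> : h *+ 4 = pi *+ 8 / N%:R by rewrite /h -mulrnAl -mulrnA.
  by rewrite -ltrBrDl ltr_pdivrMr// mulrC.
have d0 : 0 <= d.
  by apply: le_trans (Cd _ _ _ _ (Cs (circle_point 0)) (Cs (circle_point 0))).
pose p (k : nat) : circle R := circle_point (k%:R * h).
pose x k := s (p k).
have angp k : signed_angle (p k) (p k.+1) = h.
  have e : k.+1%:R * h - k%:R * h = h by rewrite -natr1; ring.
  by rewrite signed_angle_circle_point e//; apply/andP; split; lra.
have distp k : mdist (p k) (p k.+1) = h.
  by rewrite -normr_signed_angle angp ger0_norm// ltW.
have pN : p N = p 0%N by rewrite /p Nh mul0r circle_point_period.
have : forall k, exists g : R -> X, path_between (x k) (x k.+1) g /\
    (path_length g < (d + h *+ 2)%:E)%E.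
  move=> k; have [|g xg lg] := @length_space_short_path R X (x k) (x k.+1)
    (d + h *+ 2) lX; last by exists g.
  have := Cd _ _ _ _ (Cs (p k)) (Cs (p k.+1)).
  by rewrite distp -/(x k) -/(x k.+1) ler_norml => /andP[_]; lra.
move=> /choice[g Hg].
have g0 k : g k 0 = x k by have [[]] := Hg k.
have g1 k : g k 1 = x k.+1 by have [[]] := Hg k.
have gE k : g k 1 = g k.+1 0 by rewrite g0 g1.
pose G (t : R) := concat_paths g (N%:R * t).
have GE k t : 0 <= t <= 1 -> G ((k%:R + t) / N%:R) = g k t.
  move=> /andP[t0 t1]; rewrite /G mulrC divfK ?gt_eqF// (@concat_pathsE _ _ g gE k).
    by rewrite addrAC subrr add0r.
  by rewrite lerDl t0 -natr1 lerD2l.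
have loopG : path_between (x 0%N) (x 0%N) G.
  split.
  - have cg k : {within `[0, 1], continuous (g k)} by have [[]] := Hg k.
    suff : {within `[0, 1], continuous (concat_paths g \o (fun t => N%:R * t))}.
      exact.
    apply: within_continuous_precomp (concat_paths_continuous (n := N) gE cg).
      move=> t /=; rewrite !in_itv/= => /andP[t0 t1].
      by rewrite mulr_ge0//= ler_piMr.
    by move=> t; apply: cvgM; [exact: cvg_cst|exact: cvg_id].
  - have := @GE 0%N 0; rewrite addr0 mul0r => ->; first exact: g0.
    by rewrite lexx ler01.
  - have := @GE N 0; rewrite addr0 divff ?gt_eqF// => ->; last by rewrite lexx ler01.
    by rewrite g0 /x pN.
have fe y y' : mdist y y' < h -> mdist (f y) (f y') < pi / 2.
  move=> yy'; have := Cd _ _ _ _ (Cf y) (Cf y').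
  by rewrite ler_norml => /andP[+ _]; lra.
have [r r0 Hr] := nullhomotopic_winding h0 fe (scX _ _ loopG).
(* The loop is sampled at N * m + 1 times, so that each path g k is sampled at
   the multiples of 1 / m. *)
have [m m0 Hm] := exists_natr_gt r^-1.
have mR0 : 0 < m%:R :> R by rewrite ltr0n.
have [|stepG w0] := Hr (N * m)%N.
  apply: le_lt_trans (_ : m%:R^-1 < r); last by rewrite invf_plt ?posrE.
  by rewrite lef_pV2 ?posrE ?ltr0n ?muln_gt0 ?N0// ler_nat leq_pmull.
pose q k j := f (g k (j%:R / m%:R)).
have GEm k l : (l <= m)%N -> G ((k * m + l)%:R / (N * m)%:R) = g k (l%:R / m%:R).
  move=> lm; rewrite -GE ?fraction_in01//; congr G.
  by rewrite natrD !natrM; field; rewrite !gt_eqF.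
have wk k : (k < N)%N -> signed_angle (p k) (f (x k)) + winding m (q k) =
    h + signed_angle (p k.+1) (f (x k.+1)).
  move=> kN; rewrite -(angp k).
  have gm : g k (m%:R / m%:R) = x k.+1 by rewrite divff ?gt_eqF.
  have g00 : g k (0%:R / m%:R) = x k by rewrite mul0r.
  have := @winding_short_chain R X C d h Cd (ltW h0) small m
    (fun j => g k (j%:R / m%:R)) (q k) (p k) (p k.+1).
  rewrite /q gm g00; apply.
  - exact: Cs.
  - exact: Cs.
  - by rewrite distp.
  - by move=> j; exact: Cf.
  - move=> j jm; rewrite -!GEm// 1?ltnW// addnS; apply/ltW/stepG.
    by rewrite -addnS (leq_trans _ (leq_mul kN (leqnn m)))// mulSn addnC leq_add2r.
  - have [_ lg] := Hg k; rewrite -lee_fin; apply: ltW; apply: le_lt_trans lg.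
    exact: sum_mdist_le_path_length.
(* The corrections from p k to f (x k) telescope. *)
have total k : (k <= N)%N ->
    signed_angle (p 0%N) (f (x 0%N)) +
      winding (k * m) (fun j => f (G (j%:R / (N * m)%:R))) =
    k%:R * h + signed_angle (p k) (f (x k)).
  elim: k => [_|k ih kN]; first by rewrite mul0n winding0 mul0r addr0 add0r.
  rewrite mulSn addnC /winding (@big_cat_nat _ _ _ (k * m)) ?leq_addr//=.
  rewrite addrA -/(winding _ _) ih ?(ltnW kN)//.
  have -> : \sum_(k * m <= j < k * m + m)
      signed_angle (f (G (j%:R / (N * m)%:R))) (f (G (j.+1%:R / (N * m)%:R)))
      = winding m (q k).
    rewrite -{1}[(k * m)%N]add0n big_addn addKn; apply: eq_big_nat => l /andP[_ lm].
    by rewrite /q -!GEm// ?(ltnW lm)// addnS [(l + _)%N]addnC.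
  by rewrite -addrA wk// addrA -natr1 mulrDl mul1r.
have := total N (leqnn N); rewrite w0 pN -/(x 0%N) Nh /x pN => /eqP.
by rewrite addrC -subr_eq0 opprD addrA addrAC; lra.
Qed.

Theorem corollary1p4 (R : realType) (X : metricType R)
    (X_nonempty : [set: X] !=set0)
    (X_simply_connected : simply_connected R X)
    (X_length : length_space X) :
  ((pi / 4)%:E <= gromov_hausdorff_dist X (circle R))%E.
Proof.
rewrite leNgt; apply/negP => lt_pi4.
have [r GHr rpi] : exists2 r : R,
    (gromov_hausdorff_dist X (circle R) < r%:E)%E & r < pi / 4.
  case: (gromov_hausdorff_dist _ _) lt_pi4 => [a|//|].
    rewrite lte_fin => a_pi; exists ((a + pi / 4) / 2); last by lra.
    by rewrite lte_fin; lra.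
  by exists (pi / 4 - 1); [exact: ltNyr|lra].
have [C [C1 C2 C3]] := gromov_hausdorff_correspondence GHr.
have := no_small_correspondence X_simply_connected X_length C1 C2 C3.
by lra.
Qed.
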